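(* Let $\sigma<-1$ and let $F(a,b)=\operatorname{sgn}(\sigma)\,H^{\sigma}=-(a+b)^{\sigma}$ for $a,b>0$, where $H=a+b$. Then there exists no maximum-principle function (MPF) for the normal velocity $F$.
   Context: Notation: $\mathbb{R}^2_+=(0,\infty)^2$; subscripts $a,b$ denote partial derivatives. Normal velocity: a symmetric function $F\in C^2(\mathbb{R}^2_+)$, homogeneous of some degree $\sigma\in\mathbb{R}\setminus\{0\}$, with $F_a,F_b>0$ for all $a,b>0$. It is contracting if $F>0$ everywhere on $\mathbb{R}^2_+$ and expanding if $F<0$ everywhere on $\mathbb{R}^2_+$. Maximum-principle function (MPF) for a normal velocity $F$: a symmetric function $w\in C^2(\mathbb{R}^2_+)$, homogeneous of some degree $\chi\in\mathbb{R}\setminus\{0\}$, such that, with $\alpha=-w_a/w_b$ and $\alpha_a=\partial\alpha/\partial a$ (defined for $a\ne b$): (1) $w>0$ whenever $a\neq b$, and $w=0$ whenever $a=b$. (2) $\chi>0$ if $F$ is contracting, $\chi<0$ if $F$ is expanding. (3) $w_a<0$ for all $0<a<b$, and $w_a>0$ for all $0<b<a$. (4) For all $a,b>0$ (for $E_w,G_w$: $a\neq b$) one has $C_w(a,b)\le0$, $E_w(a,b)\le0$, $G_w(a,b)\le 0$, where $$C_w=w_a\,a\big((F_aa^2+F_bb^2)+(F-F_aa-F_bb)a\big)+w_b\,b\big((F_aa^2+F_bb^2)+(F-F_aa-F_bb)b\big),$$ $$E_w=w_a(F_{aa}+2F_{ab}\alpha+F_{bb}\alpha^2)-F_a(w_{aa}+2w_{ab}\alpha+w_{bb}\alpha^2)+2\,\frac{w_bF_a-w_aF_b}{a-b}\,\alpha^2,$$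 $$G_w=\frac1{\alpha^2}\Big(w_b(F_{aa}+2F_{ab}\alpha+F_{bb}\alpha^2)-F_b(w_{aa}+2w_{ab}\alpha+w_{bb}\alpha^2)+2\,\frac{w_bF_a-w_aF_b}{a-b}\Big).$$ (5) There are constants $c>0$, $d\in\mathbb{R}$ such that, evaluating $\alpha$ and $\alpha_a$ at $(a,b)=(\rho,1)$ with $0<\rho<1$: if $F$ is contracting, then either $\alpha=c$ and $\alpha_a=0$ for all sufficiently small $\rho$, or, as $\rho\to0$, $\alpha=\frac c\rho+o(\rho^{-1})$ and $\alpha_a=-\frac c{\rho^2}+o(\rho^{-1})$; if $F$ is expanding, then, as $\rho\to0$, either $\alpha=\frac c\rho+o(\rho^{-1})$ and $\alpha_a=-\frac c{\rho^2}+o(\rho^{-1})$, or $\alpha=\frac{c+d\rho}{\rho^2}+o(\rho^{-1})$ and $\alpha_a=-\frac{2c+d\rho}{\rho^3}+o(\rho^{-1})$. *)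

(* Defs.v *)
From Stdlib Require Import Reals Lra.
From Coquelicot Require Import Coquelicot.

Open Scope R_scope.

(** A function on the open quadrant is represented by a total [R -> R -> R].
    All conditions below are imposed at points of the quadrant only, and
    derivatives there depend only on the values in the (open) quadrant, so the
    values elsewhere are irrelevant. *)

Definition d_a (f : R -> R -> R) (a b : R) : R := Derive (fun x => f x b) a.
Definition d_b (f : R -> R -> R) (a b : R) : R := Derive (fun y => f a y) b.

(** [ex_diff_n f 2 a b] asserts that [f] and its partial derivatives of order
    at most 2 (in either order of differentiation) exist at [(a, b)] and are
    jointly continuous there. *)
Definition C2_quadrant (f : R -> R -> R) : Prop :=
  forall a b, 0 < a -> 0 < b -> ex_diff_n f 2 a b.

Definition symmetric (f : R -> R -> R) : Prop :=
  forall a b, 0 < a -> 0 < b -> f a b = f b a.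

Definition homogeneous (s : R) (f : R -> R -> R) : Prop :=
  forall t a b, 0 < t -> 0 < a -> 0 < b ->
    f (t * a) (t * b) = Rpower t s * f a b.

Record normal_velocity (F : R -> R -> R) : Prop := {
  nv_sym : symmetric F;
  nv_C2 : C2_quadrant F;
  nv_hom : exists sigma, sigma <> 0 /\ homogeneous sigma F;
  nv_mono : forall a b, 0 < a -> 0 < b -> 0 < d_a F a b /\ 0 < d_b F a b
}.

Definition contracting (F : R -> R -> R) : Prop :=
  forall a b, 0 < a -> 0 < b -> 0 < F a b.

Definition expanding (F : R -> R -> R) : Prop :=
  forall a b, 0 < a -> 0 < b -> F a b < 0.

Definition alpha (w : R -> R -> R) (a b : R) : R := - (d_a w a b / d_b w a b).

Definition C_term (F w : R -> R -> R) (a b : R) : R :=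
  let Fa := d_a F a b in
  let Fb := d_b F a b in
  d_a w a b * a
    * ((Fa * a ^ 2 + Fb * b ^ 2) + (F a b - Fa * a - Fb * b) * a)
  + d_b w a b * b
    * ((Fa * a ^ 2 + Fb * b ^ 2) + (F a b - Fa * a - Fb * b) * b).

(** [f_aa + 2 f_ab al + f_bb al^2] *)
Definition quad2 (f : R -> R -> R) (al a b : R) : R :=
  d_a (d_a f) a b + 2 * d_b (d_a f) a b * al + d_b (d_b f) a b * al ^ 2.

Definition E_term (F w : R -> R -> R) (a b : R) : R :=
  let al := alpha w a b in
  d_a w a b * quad2 F al a b - d_a F a b * quad2 w al a b
  + 2 * ((d_b w a b * d_a F a b - d_a w a b * d_b F a b) / (a - b)) * al ^ 2.

Definition G_term (F w : R -> R -> R) (a b : R) : R :=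
  let al := alpha w a b in
  / al ^ 2
  * (d_b w a b * quad2 F al a b - d_b F a b * quad2 w al a b
     + 2 * ((d_b w a b * d_a F a b - d_a w a b * d_b F a b) / (a - b))).

(** [f rho = g rho + o(1/rho)] as [rho] tends to 0 from the right;
    [is_domin l u v] is the library's [v = o(u)] along [l]. *)
Definition eq_o_inv (f g : R -> R) : Prop :=
  is_domin (at_right 0) (fun rho => / rho) (fun rho => f rho - g rho).

Definition alpha_constant (w : R -> R -> R) (c : R) : Prop :=
  at_right 0 (fun rho => alpha w rho 1 = c /\ d_a (alpha w) rho 1 = 0).

Definition alpha_simple_pole (w : R -> R -> R) (c : R) : Prop :=
  eq_o_inv (fun rho => alpha w rho 1) (fun rho => c / rho) /\
  eq_o_inv (fun rho => d_a (alpha w) rho 1) (fun rho => - (c / rho ^ 2)).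

Definition alpha_double_pole (w : R -> R -> R) (c d : R) : Prop :=
  eq_o_inv (fun rho => alpha w rho 1) (fun rho => (c + d * rho) / rho ^ 2) /\
  eq_o_inv (fun rho => d_a (alpha w) rho 1)
    (fun rho => - ((2 * c + d * rho) / rho ^ 3)).

Record MPF (F w : R -> R -> R) : Prop := {
  mpf_sym : symmetric w;
  mpf_C2 : C2_quadrant w;
  mpf_hom : exists chi, chi <> 0 /\ homogeneous chi w /\
    (contracting F -> 0 < chi) /\ (expanding F -> chi < 0);
  mpf_pos : forall a b, 0 < a -> 0 < b -> a <> b -> 0 < w a b;
  mpf_diag : forall a, 0 < a -> w a a = 0;
  mpf_mono_lt : forall a b, 0 < a -> a < b -> d_a w a b < 0;
  mpf_mono_gt : forall a b, 0 < b -> b < a -> 0 < d_a w a b;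
  mpf_C : forall a b, 0 < a -> 0 < b -> C_term F w a b <= 0;
  mpf_E : forall a b, 0 < a -> 0 < b -> a <> b -> E_term F w a b <= 0;
  mpf_G : forall a b, 0 < a -> 0 < b -> a <> b -> G_term F w a b <= 0;
  mpf_asymp : exists c d, 0 < c /\
    (contracting F -> alpha_constant w c \/ alpha_simple_pole w c) /\
    (expanding F -> alpha_simple_pole w c \/ alpha_double_pole w c d)
}.

Definition H_power (sigma a b : R) : R := sign sigma * Rpower (a + b) sigma.

(** [MPF F] makes sense for any [F]; the facts below check that [H_power sigma]
    is indeed a normal velocity, and an expanding one when [sigma < 0]. *)

Lemma is_derive_Rpower_lin (k s r x : R) : 0 < x + r ->
  is_derive (fun z => k * Rpower (z + r) s) x (k * s * Rpower (x + r) (s - 1)).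
Proof.
intros Hx; apply is_derive_Reals.
replace (k * s * Rpower (x + r) (s - 1))
  with (k * (s * Rpower (x + r) (s - 1) * 1)) by ring.
apply (derivable_pt_lim_scal (fun z => Rpower (z + r) s)).
apply (derivable_pt_lim_comp (fun z => z + r) (fun z => Rpower z s)).
- apply is_derive_Reals; auto_derive; trivial; ring.
- now apply derivable_pt_lim_power.
Qed.

Lemma Derive_H_a (k s a b : R) : 0 < a + b ->
  d_a (fun x y => k * Rpower (x + y) s) a b = k * s * Rpower (a + b) (s - 1).
Proof. intros H; apply is_derive_unique; now apply is_derive_Rpower_lin. Qed.

Lemma Derive_H_b (k s a b : R) : 0 < a + b ->
  d_b (fun x y => k * Rpower (x + y) s) a b = k * s * Rpower (a + b) (s - 1).
Proof.
intros H; unfold d_b.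
rewrite (Derive_ext _ (fun y => k * Rpower (y + a) s)).
- rewrite (Rplus_comm a b).
  apply is_derive_unique; apply is_derive_Rpower_lin; lra.
- intros t; now rewrite (Rplus_comm a t).
Qed.

Lemma locally_2d_sum_pos (P : R -> R -> Prop) (a b : R) : 0 < a + b ->
  (forall u v, 0 < u + v -> P u v) -> locally_2d P a b.
Proof.
intros H HP.
assert (Hd : 0 < (a + b) / 2) by lra.
exists (mkposreal _ Hd); simpl; intros u v Hu Hv; apply HP.
apply Rabs_def2 in Hu; apply Rabs_def2 in Hv; lra.
Qed.

Lemma ex_diff_n_H (n : nat) (k s a b : R) : 0 < a + b ->
  ex_diff_n (fun x y => k * Rpower (x + y) s) n a b.
Proof.
revert k s; induction n as [|n IH]; intros k s H.
all: assert (Hc : continuity_2d_pt (fun x y => k * Rpower (x + y) s) a b) by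
  (apply continuity_2d_pt_mult; [apply continuity_2d_pt_const|];
   apply (continuity_1d_2d_pt_comp (fun z => Rpower z s));
   [ apply derivable_continuous_pt; exists (s * Rpower (a + b) (s - 1));
     now apply derivable_pt_lim_power
   | apply continuity_2d_pt_plus;
     [apply continuity_2d_pt_id1 | apply continuity_2d_pt_id2] ]).
- now split.
- split; [exact Hc | split; [|split; [|split]]].
  + eexists; now apply is_derive_Rpower_lin.
  + apply (ex_derive_ext (fun y => k * Rpower (y + a) s)).
    * intros t; now rewrite (Rplus_comm t a).
    * eexists; apply is_derive_Rpower_lin; lra.
  + apply (ex_diff_n_ext_loc (fun x y => k * s * Rpower (x + y) (s - 1))).
    * apply locally_2d_sum_pos; trivial; intros u v Huv.
      symmetry; now apply Derive_H_a.
    * now apply IH.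
  + apply (ex_diff_n_ext_loc (fun x y => k * s * Rpower (x + y) (s - 1))).
    * apply locally_2d_sum_pos; trivial; intros u v Huv.
      symmetry; now apply Derive_H_b.
    * now apply IH.
Qed.

Lemma sign_mul_pos (s : R) : s <> 0 -> 0 < sign s * s.
Proof.
intros Hs; destruct (Rtotal_order s 0) as [H | [H | H]].
- rewrite (sign_eq_m1 s H); lra.
- contradiction.
- rewrite (sign_eq_1 s H); lra.
Qed.

Lemma normal_velocity_H_power (sigma : R) :
  sigma <> 0 -> normal_velocity (H_power sigma).
Proof.
intros Hs; split.
- intros a b _ _; unfold H_power; now rewrite (Rplus_comm a b).
- intros a b Ha Hb; apply (ex_diff_n_H 2); lra.
- exists sigma; split; trivial; intros t a b Ht Ha Hb; unfold H_power.
  rewrite <- Rmult_plus_distr_l, <- Rpower_mult_distr by lra; ring.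
- intros a b Ha Hb; unfold H_power.
  rewrite Derive_H_a, Derive_H_b by lra.
  assert (0 < sign sigma * sigma * Rpower (a + b) (sigma - 1))
    by (apply Rmult_lt_0_compat; [now apply sign_mul_pos | apply exp_pos]).
  now split.
Qed.

Lemma H_power_neg (sigma a b : R) :
  sigma < 0 -> H_power sigma a b = - Rpower (a + b) sigma.
Proof. intros Hs; unfold H_power; rewrite (sign_eq_m1 sigma Hs); ring. Qed.

Lemma expanding_H_power (sigma : R) : sigma < 0 -> expanding (H_power sigma).
Proof.
intros Hs a b _ _; rewrite (H_power_neg sigma a b Hs).
apply Ropp_lt_gt_0_contravar, exp_pos.
Qed.

(* Main.v *)
Require Import Defs.
From Stdlib Require Import Reals Lra.
From Coquelicot Require Import Coquelicot.

Open Scope R_scope.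

(** Along [(rho, 1)] with [rho -> 0] the condition [E_w <= 0] fails.  Euler's
    relation turns the Hessian term of [w] into [-chi w alpha_a], and since
    [F_a = F_b] and [F_aa = F_ab = F_bb], dividing [E_w] by [w_b F_a] leaves
    [alpha (1 + alpha) ((1 - sigma) (1 + alpha) / (1 + rho)
       - 2 alpha / (1 - rho)) + chi w alpha_a / w_b].
    The bracket is positive for small [rho] because [1 - sigma > 2], while
    [chi < 0] and both expanding asymptotics make [alpha_a] eventually
    negative. *)

(** * Localisation in the open quadrant *)

Lemma locally_2d_quadrant (P : R -> R -> Prop) (a b : R) : 0 < a -> 0 < b ->
  (forall u v, 0 < u -> 0 < v -> P u v) -> locally_2d P a b.
Proof.
intros Ha Hb HP.
exists (mkposreal _ (Rmin_stable_in_posreal (mkposreal a Ha) (mkposreal b Hb))).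
simpl; intros u v Hu Hv.
generalize (Rmin_l a b) (Rmin_r a b); intros Hl Hr.
apply Rabs_def2 in Hu; apply Rabs_def2 in Hv; apply HP; lra.
Qed.

Lemma locally_pos (P : R -> Prop) (a : R) : 0 < a ->
  (forall u, 0 < u -> P u) -> locally a P.
Proof.
intros Ha HP; exists (mkposreal a Ha); intros u Hu.
apply Rabs_def2 in Hu; unfold minus, plus, opp in Hu; simpl in Hu.
apply HP; lra.
Qed.

Lemma is_derive_id_mult (f : R -> R) (x l : R) : is_derive f x l ->
  is_derive (fun y => y * f y) x (f x + x * l).
Proof.
intros Hf; rewrite <- (Rmult_1_l (f x)).
apply (is_derive_mult (K := R_AbsRing) (fun y => y) f x 1 l).
- apply (is_derive_id (K := R_AbsRing)).
- exact Hf.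
- exact Rmult_comm.
Qed.

(** * Derivatives of [C2_quadrant] functions *)

Section C2.

Variable f : R -> R -> R.
Hypothesis f_C2 : C2_quadrant f.

Lemma C2_is_derive_a (a b : R) : 0 < a -> 0 < b ->
  is_derive (fun x => f x b) a (d_a f a b).
Proof. intros Ha Hb; apply Derive_correct, (f_C2 a b Ha Hb). Qed.

Lemma C2_is_derive_b (a b : R) : 0 < a -> 0 < b ->
  is_derive (fun y => f a y) b (d_b f a b).
Proof. intros Ha Hb; apply Derive_correct, (f_C2 a b Ha Hb). Qed.

Lemma C2_is_derive_aa (a b : R) : 0 < a -> 0 < b ->
  is_derive (fun x => d_a f x b) a (d_a (d_a f) a b).
Proof.
intros Ha Hb; apply Derive_correct.
apply (ex_diff_n_deriv_aux1 _ _ _ _ (f_C2 a b Ha Hb)).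
Qed.

Lemma C2_is_derive_ab (a b : R) : 0 < a -> 0 < b ->
  is_derive (fun y => d_a f a y) b (d_b (d_a f) a b).
Proof.
intros Ha Hb; apply Derive_correct.
apply (ex_diff_n_deriv_aux1 _ _ _ _ (f_C2 a b Ha Hb)).
Qed.

Lemma C2_is_derive_bb (a b : R) : 0 < a -> 0 < b ->
  is_derive (fun y => d_b f a y) b (d_b (d_b f) a b).
Proof.
intros Ha Hb; apply Derive_correct.
apply (ex_diff_n_deriv_aux2 _ _ _ _ (f_C2 a b Ha Hb)).
Qed.

Lemma C2_mixed (a b : R) : 0 < a -> 0 < b -> d_a (d_b f) a b = d_b (d_a f) a b.
Proof.
intros Ha Hb; apply (Schwarz f a b).
- apply locally_2d_quadrant; trivial; intros u v Hu Hv.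
  generalize (f_C2 u v Hu Hv); intros H; repeat split; apply H.
- apply (ex_diff_n_deriv_aux2 _ _ _ _ (f_C2 a b Ha Hb)).
- apply (ex_diff_n_deriv_aux1 _ _ _ _ (f_C2 a b Ha Hb)).
Qed.

(** By Schwarz, mixed derivatives are normalised to [d_b (d_a f)], the form that occurs in
    [quad2]. *)
Lemma C2_is_derive_ba (a b : R) : 0 < a -> 0 < b ->
  is_derive (fun x => d_b f x b) a (d_b (d_a f) a b).
Proof.
intros Ha Hb; rewrite <- C2_mixed by trivial; apply Derive_correct.
apply (ex_diff_n_deriv_aux2 _ _ _ _ (f_C2 a b Ha Hb)).
Qed.

Lemma C2_differentiable (a b : R) : 0 < a -> 0 < b ->
  differentiable_pt_lim f a b (d_a f a b) (d_b f a b).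
Proof.
intros Ha Hb; apply filterdiff_differentiable_pt_lim.
(* Differentiability follows from one partial derivative that exists nearby and is continuous at the
   point, and the other at the point alone. *)
apply (is_derive_filterdiff f a b (d_a f)).
- apply (locally_2d_locally
    (fun u v => is_derive (fun z => f z v) u (d_a f u v))).
  apply locally_2d_quadrant; trivial; apply C2_is_derive_a.
- now apply C2_is_derive_b.
- apply (continuity_2d_pt_filterlim (d_a f)).
  apply (ex_diff_n_deriv_aux1 _ _ _ _ (f_C2 a b Ha Hb)).
Qed.

(** * Euler relations for homogeneous functions *)

Variable s : R.
Hypothesis f_hom : homogeneous s f.

(** Differentiate [f (t * a) (t * b)] at [t = 1] twice: by the chain rule, and as [t^s * f a b]. *)
Lemma euler_identity (a b : R) : 0 < a -> 0 < b ->
  a * d_a f a b + b * d_b f a b = s * f a b.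
Proof.
intros Ha Hb.
assert (H1 : is_derive (fun t => f (t * a) (t * b)) 1
               (d_a f a b * a + d_b f a b * b)).
{ apply is_derive_Reals.
  apply (derivable_pt_lim_comp_2d f (fun t => t * a) (fun t => t * b)).
  - rewrite !Rmult_1_l; now apply C2_differentiable.
  - apply is_derive_Reals; auto_derive; trivial; simpl; ring.
  - apply is_derive_Reals; auto_derive; trivial; simpl; ring. }
assert (H2 : is_derive (fun t => f (t * a) (t * b)) 1 (s * f a b)).
{ apply (is_derive_ext_loc (fun t => f a b * Rpower (t + 0) s)).
  - apply locally_pos; [lra|]; intros t Ht.
    rewrite f_hom, Rplus_0_r by trivial; apply Rmult_comm.
  - replace (s * f a b) with (f a b * s * Rpower (1 + 0) (s - 1)).
    + apply is_derive_Rpower_lin; lra.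
    + rewrite Rplus_0_r; unfold Rpower; rewrite ln_1, Rmult_0_r, exp_0; ring. }
apply is_derive_unique in H1; apply is_derive_unique in H2; lra.
Qed.

(** Obtained by differentiating Euler's relation in [a]; the next lemma does the same in [b]. *)
Lemma euler_identity_a (a b : R) : 0 < a -> 0 < b ->
  a * d_a (d_a f) a b + b * d_b (d_a f) a b = (s - 1) * d_a f a b.
Proof.
intros Ha Hb.
assert (H1 : is_derive (fun x => s * f x b) a (s * d_a f a b))
  by (apply is_derive_scal; now apply C2_is_derive_a).
assert (H2 : is_derive (fun x => s * f x b) a
   ((d_a f a b + a * d_a (d_a f) a b) + b * d_b (d_a f) a b)).
{ apply (is_derive_ext_loc (fun x => x * d_a f x b + b * d_b f x b)).
  - apply locally_pos; trivial; intros x Hx; now apply euler_identity.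
  - apply (is_derive_plus (fun x => x * d_a f x b) (fun x => b * d_b f x b)).
    + apply (is_derive_id_mult (fun x => d_a f x b)); now apply C2_is_derive_aa.
    + apply is_derive_scal; now apply C2_is_derive_ba. }
apply is_derive_unique in H1; apply is_derive_unique in H2; lra.
Qed.

Lemma euler_identity_b (a b : R) : 0 < a -> 0 < b ->
  a * d_b (d_a f) a b + b * d_b (d_b f) a b = (s - 1) * d_b f a b.
Proof.
intros Ha Hb.
assert (H1 : is_derive (fun y => s * f a y) b (s * d_b f a b))
  by (apply is_derive_scal; now apply C2_is_derive_b).
assert (H2 : is_derive (fun y => s * f a y) b
   (a * d_b (d_a f) a b + (d_b f a b + b * d_b (d_b f) a b))).
{ apply (is_derive_ext_loc (fun y => a * d_a f a y + y * d_b f a y)).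
  - apply locally_pos; trivial; intros y Hy; now apply euler_identity.
  - apply (is_derive_plus (fun y => a * d_a f a y) (fun y => y * d_b f a y)).
    + apply is_derive_scal; now apply C2_is_derive_ab.
    + apply (is_derive_id_mult (fun y => d_b f a y)); now apply C2_is_derive_bb. }
apply is_derive_unique in H1; apply is_derive_unique in H2; lra.
Qed.

Lemma d_a_alpha (a b : R) : 0 < a -> 0 < b -> d_b f a b <> 0 ->
  d_a (alpha f) a b
  = - ((d_a (d_a f) a b * d_b f a b - d_a f a b * d_b (d_a f) a b)
       / d_b f a b ^ 2).
Proof.
intros Ha Hb Hq; apply is_derive_unique.
apply (is_derive_opp (fun x => d_a f x b / d_b f x b)).
apply (is_derive_div (fun x => d_a f x b) (fun x => d_b f x b)); trivial.
- now apply C2_is_derive_aa.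
- now apply C2_is_derive_ba.
Qed.

(** The differentiated Euler relations express the mixed and the [bb] derivatives through the [aa]
    one and the gradient; after this elimination both sides are the same rational expression. *)
Lemma quad2_alpha (a b : R) : 0 < a -> 0 < b -> d_b f a b <> 0 ->
  b * quad2 f (alpha f a b) a b = - (s * f a b * d_a (alpha f) a b).
Proof.
intros Ha Hb Hq.
generalize (euler_identity a b Ha Hb) (euler_identity_a a b Ha Hb)
  (euler_identity_b a b Ha Hb).
rewrite d_a_alpha by trivial; unfold quad2, alpha; intros <- H2 H3.
set (p := d_a f a b) in *; set (q := d_b f a b) in *.
set (W := d_a (d_a f) a b) in *; set (M := d_b (d_a f) a b) in *.
set (N := d_b (d_b f) a b) in *.
assert (HM : b * M = (s - 1) * p - a * W) by lra.
assert (HN : b * (b * N) = b * ((s - 1) * q) - a * (b * M))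
  by (rewrite <- H3; ring).
(* A second factor [b] makes the derivatives appear only as [b * M] and [b * (b * N)], which [HM]
   and [HN] rewrite. *)
apply (Rmult_eq_reg_l b); [|lra].
transitivity (b * b * W + 2 * b * (b * M) * - (p / q)
              + (b * (b * N)) * (p / q) ^ 2); [field; trivial|].
transitivity ((b * W * q - p * (b * M)) / q ^ 2 * (a * p + b * q));
  [|field; trivial].
rewrite HN, HM; field; trivial.
Qed.

End C2.

(** An MPF has prescribed signs for [w_a] only; symmetry transfers them to [w_b]. *)
Lemma symmetric_d_b (f : R -> R -> R) (a b : R) : symmetric f ->
  0 < a -> 0 < b -> d_b f a b = d_a f b a.
Proof.
intros Hf Ha Hb; apply Derive_ext_loc.
apply locally_pos; trivial; intros y Hy; now apply Hf.
Qed.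

(** * Sign of [alpha_a] near the boundary *)

Lemma at_right_0_intro (P : R -> Prop) (r : R) : 0 < r ->
  (forall x, 0 < x < r -> P x) -> at_right 0 P.
Proof.
intros Hr HP; exists (mkposreal r Hr); intros x Hx Hx0.
apply Rabs_def2 in Hx; unfold minus, plus, opp in Hx; simpl in Hx.
apply HP; lra.
Qed.

(** Little-o with constant 1. An upper bound is enough to conclude that [alpha_a] is negative. *)
Lemma eq_o_inv_bound (f g : R -> R) : eq_o_inv f g ->
  at_right 0 (fun rho => f rho <= g rho + / rho).
Proof.
intros H; destruct (H (mkposreal 1 Rlt_0_1)) as [d Hd].
exists d; intros x Hx Hx0; generalize (Hd x Hx Hx0).
change (Rabs (f x - g x) <= 1 * Rabs (/ x) -> f x <= g x + / x).
rewrite (Rabs_pos_eq (/ x)) by now left; apply Rinv_0_lt_compat.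
intros Hb; generalize (Rle_abs (f x - g x)); lra.
Qed.

(** The pole absorbs the error: the upper bound is [- (c - x) / x^2], negative for [x < c]. *)
Lemma alpha_simple_pole_decr (w : R -> R -> R) (c : R) : 0 < c ->
  alpha_simple_pole w c -> at_right 0 (fun rho => d_a (alpha w) rho 1 < 0).
Proof.
intros Hc [_ H].
generalize (filter_and _ _ (eq_o_inv_bound _ _ H)
  (at_right_0_intro (fun x => 0 < x < c) c Hc (fun x Hx => Hx))).
apply filter_imp; intros x [Hle Hx].
apply (Rle_lt_trans _ _ _ Hle).
replace (- (c / x ^ 2) + / x) with (- ((c - x) * / x ^ 2)) by (field; lra).
apply Ropp_lt_gt_0_contravar, Rmult_lt_0_compat; [lra|].
apply Rinv_0_lt_compat, pow_lt; lra.
Qed.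

Lemma alpha_double_pole_decr (w : R -> R -> R) (c d : R) : 0 < c ->
  alpha_double_pole w c d -> at_right 0 (fun rho => d_a (alpha w) rho 1 < 0).
Proof.
intros Hc [_ H].
assert (Hd : 0 < 1 + Rabs d) by (generalize (Rabs_pos d); lra).
(* Below this radius [x^2 < x] and [x * (1 + Rabs d) < c], so [x^2 - d * x < c < 2 * c] and the
   numerator [2 * c + d * x - x^2] is positive. *)
assert (Hr : 0 < Rmin 1 (c / (1 + Rabs d)))
  by (apply Rmin_glb_lt; [lra | now apply Rdiv_lt_0_compat]).
generalize (filter_and _ _ (eq_o_inv_bound _ _ H)
  (at_right_0_intro (fun x => 0 < x < _) _ Hr (fun x Hx => Hx))).
apply filter_imp; intros x [Hle [Hx0 Hx]].
assert (Hx1 : x < 1) by (eapply Rlt_le_trans; [exact Hx | apply Rmin_l]).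
assert (Hxc : x * (1 + Rabs d) < c).
{ apply Rlt_div_r; trivial.
  eapply Rlt_le_trans; [exact Hx | apply Rmin_r]. }
apply (Rle_lt_trans _ _ _ Hle).
replace (- ((2 * c + d * x) / x ^ 3) + / x)
  with (- ((2 * c + d * x - x * x) * / x ^ 3)) by (field; lra).
apply Ropp_lt_gt_0_contravar, Rmult_lt_0_compat.
- assert (x * - d <= x * Rabs d).
  { apply Rmult_le_compat_l; [lra|]; rewrite <- Rabs_Ropp; apply Rle_abs. }
  assert (x * x < x * 1) by (apply Rmult_lt_compat_l; lra).
  lra.
- apply Rinv_0_lt_compat, pow_lt; lra.
Qed.

(** * Positivity of [E_term] for powers of [H] *)

(** Since [H_power sigma] depends on [a + b] alone, its second derivatives coincide and the
    quadratic form is a multiple of a perfect square. *)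
Lemma quad2_H_power (sigma al a b : R) : 0 < a + b ->
  quad2 (H_power sigma) al a b
  = sign sigma * sigma * (sigma - 1) * Rpower (a + b) (sigma - 1 - 1)
    * (1 + al) ^ 2.
Proof.
intros H; unfold quad2.
set (k := sign sigma * sigma).
assert (Ha : locally_2d (fun u v => d_a (H_power sigma) u v
                          = k * Rpower (u + v) (sigma - 1)) a b)
  by (apply locally_2d_sum_pos; trivial; intros; now apply Derive_H_a).
assert (Hb : locally_2d (fun u v => d_b (H_power sigma) u v
                          = k * Rpower (u + v) (sigma - 1)) a b)
  by (apply locally_2d_sum_pos; trivial; intros; now apply Derive_H_b).
assert (Haa : d_a (d_a (H_power sigma)) a b
              = k * (sigma - 1) * Rpower (a + b) (sigma - 1 - 1)).
{ rewrite <- Derive_H_a by trivial; apply Derive_ext_loc.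
  apply (locally_2d_1d_const_y _ _ _ Ha). }
assert (Hab : d_b (d_a (H_power sigma)) a b
              = k * (sigma - 1) * Rpower (a + b) (sigma - 1 - 1)).
{ rewrite <- Derive_H_b by trivial; apply Derive_ext_loc.
  apply (locally_2d_1d_const_x _ _ _ Ha). }
assert (Hbb : d_b (d_b (H_power sigma)) a b
              = k * (sigma - 1) * Rpower (a + b) (sigma - 1 - 1)).
{ rewrite <- Derive_H_b by trivial; apply Derive_ext_loc.
  apply (locally_2d_1d_const_x _ _ _ Hb). }
rewrite Haa, Hab, Hbb; ring.
Qed.

Lemma E_term_H_power_pos (sigma chi rho : R) (w : R -> R -> R) :
  sigma <> 0 -> C2_quadrant w -> homogeneous chi w -> chi < 0 ->
  0 < rho < 1 -> 2 * (1 + rho) < (1 - sigma) * (1 - rho) ->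
  0 < w rho 1 -> d_a w rho 1 < 0 -> 0 < d_b w rho 1 ->
  d_a (alpha w) rho 1 < 0 -> 0 < E_term (H_power sigma) w rho 1.
Proof.
intros Hs HC2 Hhom Hchi [Hr0 Hr1] Hr Hw Hp Hq Hal.
assert (HQ := quad2_alpha w HC2 chi Hhom rho 1 Hr0 Rlt_0_1 (Rgt_not_eq _ _ Hq)).
rewrite Rmult_1_l in HQ.
unfold E_term; cbv zeta.
rewrite HQ, quad2_H_power by lra.
unfold H_power; rewrite Derive_H_a, Derive_H_b by lra.
(* First derivatives are written with the power from the second ones, so that it factors out as
   [g]. *)
assert (HR : Rpower (rho + 1) (sigma - 1)
             = (rho + 1) * Rpower (rho + 1) (sigma - 1 - 1)).
{ rewrite <- (Rpower_1 (rho + 1)) at 2 by lra.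
  rewrite <- Rpower_plus; f_equal; ring. }
rewrite HR.
assert (Hk := sign_mul_pos sigma Hs); set (k := sign sigma * sigma) in *.
assert (Hg : 0 < Rpower (rho + 1) (sigma - 1 - 1)) by apply exp_pos.
set (g := Rpower (rho + 1) (sigma - 1 - 1)) in *.
set (q := d_b w rho 1) in *.
assert (Hp_al : d_a w rho 1 = - (alpha w rho 1 * q))
  by (unfold alpha; fold q; field; lra).
assert (Ha : 0 < alpha w rho 1).
{ apply (Rmult_lt_reg_r q); trivial; lra. }
rewrite Hp_al.
set (al := alpha w rho 1) in *; set (al' := d_a (alpha w) rho 1) in *.
(* With [w_a = - alpha * w_b], the terms without second derivatives of [w] combine into the bracket;
   the Euler term is a product of [- chi > 0] and [- al' > 0]. *)
replace (- (al * q) * (k * (sigma - 1) * g * (1 + al) ^ 2)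
   - k * ((rho + 1) * g) * - (chi * w rho 1 * al')
   + 2 * ((q * (k * ((rho + 1) * g)) - - (al * q) * (k * ((rho + 1) * g)))
          / (rho - 1)) * al ^ 2)
  with (k * g * (q * al * (1 + al) * / (1 - rho)
          * ((1 - sigma) * (1 - rho) * (1 + al) - 2 * (1 + rho) * al)
        + (rho + 1) * w rho 1 * ((- chi) * (- al')))) by (field; lra).
apply Rmult_lt_0_compat; [now apply Rmult_lt_0_compat|].
apply Rplus_lt_0_compat; repeat apply Rmult_lt_0_compat; try lra.
- apply Rinv_0_lt_compat; lra.
(* The hypothesis on [rho] times [al]; the remaining summand [(1 - sigma) * (1 - rho)] is positive
   too. *)
- assert (2 * (1 + rho) * al < (1 - sigma) * (1 - rho) * al)
    by (apply Rmult_lt_compat_r; lra).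
  lra.
Qed.

(** * Choice of [rho] and contradiction *)

Theorem theorem8p1 (sigma : R) (Hsigma : sigma < -1) :
  ~ exists w : R -> R -> R, MPF (H_power sigma) w.
Proof.
intros [w H].
assert (Hexp : expanding (H_power sigma)) by (apply expanding_H_power; lra).
destruct (mpf_hom _ _ H) as [chi [_ [Hhom [_ Hchi]]]].
specialize (Hchi Hexp).
assert (Hdecr : at_right 0 (fun rho => d_a (alpha w) rho 1 < 0)).
{ destruct (mpf_asymp _ _ H) as [c [d [Hc [_ Has]]]].
  destruct (Has Hexp).
  - now apply (alpha_simple_pole_decr w c).
  - now apply (alpha_double_pole_decr w c d). }
(* This threshold solves [2 * (1 + rho) = (1 - sigma) * (1 - rho)] for [rho]; it is positive because
   [sigma < -1]. *)
assert (Hr : 0 < (- 1 - sigma) / (3 - sigma)) by (apply Rdiv_lt_0_compat; lra).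
destruct (filter_ex (F := at_right 0) _ (filter_and _ _ Hdecr
  (at_right_0_intro (fun x => 0 < x < _) _ Hr (fun x Hx => Hx))))
  as [rho [Hal [Hr0 Hrho]]].
apply Rlt_div_r in Hrho; [|lra].
assert (Hr1 : rho < 1) by nra.
apply (Rlt_not_le (E_term (H_power sigma) w rho 1) 0); [|apply H; lra].
apply (E_term_H_power_pos sigma chi); try apply H; try lra; trivial.
rewrite symmetric_d_b by (try apply H; lra); apply H; lra.
Qed.
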